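(* Let $s>1$ be an integer, $z\in\mathbb{C}$ and $a$ a parameter for which $\Phi(z,s,a)$ is defined. If the integral converges, then \[ \Phi(z,s,a)=\frac{-s}{(s-1)!}\int_0^1\!\!\int_0^1\frac{(xy)^{a-1}\left(-\log(y)\right)^{s-1}}{(1-zxy)\log(xy)}\,dx\,dy, \] and \[ \zeta(s)=\frac{s}{(s-1)!}(-1)^s\int_0^1\!\!\int_0^1\frac{\log^{s-1}(y)}{(1-xy)\log(xy)}\,dx\,dy. \]
   Context: The Lerch transcendent is $\Phi(z,s,a)=\sum_{k=0}^\infty \frac{z^k}{(k+a)^s}$ (where this series converges); $\zeta$ is the Riemann zeta function. *)

(* Defs.v *)
From HB Require Import structures.
From mathcomp Require Import all_boot all_order all_algebra.
From mathcomp Require Import all_classical all_reals all_analysis.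
From mathcomp Require Import complex.

Set Implicit Arguments.
Unset Strict Implicit.
Unset Printing Implicit Defensive.

Import Order.TTheory GRing.Theory Num.Theory.
Import numFieldNormedType.Exports.

Local Open Scope classical_set_scope.
Local Open Scope ring_scope.

Section Defs.
Variable R : realType.

Definition leb2 := (@lebesgue_measure R \x @lebesgue_measure R)%E.

Definition unit_square : set (R * R) := `]0, 1[ `*` `]0, 1[.

(* Principal power t^w for a positive real t and complex w:
   t^w = exp(w log t) = e^{Re w log t} (cos(Im w log t) + i sin(Im w log t)). *)
Definition cpowR (t : R) (w : R[i]) : R[i] :=
  ((expR (complex.Re w * ln t))%:C *
   (cos (complex.Im w * ln t) +i* sin (complex.Im w * ln t)))%C.

Definition cintegrable (f : R * R -> R[i]) : Prop :=
  leb2.-integrable unit_square (EFin \o (fun p => complex.Re (f p))) /\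
  leb2.-integrable unit_square (EFin \o (fun p => complex.Im (f p))).

Definition cintegral (f : R * R -> R[i]) : R[i] :=
  ((Rintegral leb2 unit_square (fun p => complex.Re (f p))) +i*
   (Rintegral leb2 unit_square (fun p => complex.Im (f p))))%C.

Definition cseries_to (u : nat -> R[i]) (l : R[i]) : Prop :=
  (fun n => complex.Re (\sum_(k < n) u k)) @ \oo --> complex.Re l /\
  (fun n => complex.Im (\sum_(k < n) u k)) @ \oo --> complex.Im l.

Definition lerch_term (z : R[i]) (s : nat) (a : R[i]) (k : nat) : R[i] :=
  z ^+ k / (k%:R + a) ^+ s.

(* Phi(z,s,a) is defined: no term has a vanishing denominator and the series
   converges.  Its value is then the (unique) sum of the series. *)
Definition lerch_defined (z : R[i]) (s : nat) (a : R[i]) : Prop :=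
  (forall k : nat, k%:R + a != 0) /\ exists l, cseries_to (lerch_term z s a) l.

Definition riemann_zeta (s : nat) : R :=
  limn (fun n : nat => \sum_(k < n) ((k.+1)%:R ^- s : R)).

Definition lerch_integrand (z : R[i]) (s : nat) (a : R[i]) (p : R * R) : R[i] :=
  (cpowR (p.1 * p.2) (a - 1) * ((- ln p.2) ^+ s.-1)%:C /
  ((1 - z * (p.1 * p.2)%:C) * (ln (p.1 * p.2))%:C))%C.

Definition zeta_integrand (s : nat) (p : R * R) : R :=
  (ln p.2) ^+ s.-1 / ((1 - p.1 * p.2) * ln (p.1 * p.2)).

End Defs.

(* Main.v *)
(** Substituting u = xy for x turns the double integral of G(xy) (-log y)^(s-1)
    into the integral over ]0,1[ of G(u) (-log u)^s / s, by Tonelli and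
    int_u^1 (-log y)^(s-1) dy/y = (-log u)^s / s; with G(u) = u^(a-1) / ((1-zu) log u)
    the factor log u cancels.  Convergence of the Lerch series forces |z| <= 1 and
    integrability forces Re a > 0.  Expanding 1/(1-zu) as a finite geometric sum,
    the terms integrate to z^k (s-1)!/(a+k)^s and the remainder, the integral of
    (zu)^n times the integrand, vanishes by dominated convergence.  The zeta
    formula is the case z = a = 1. *)

Require Import Defs.
From HB Require Import structures.
From mathcomp Require Import all_boot all_order all_algebra.
From mathcomp Require Import all_classical all_reals all_analysis.
From mathcomp Require Import complex.
From mathcomp Require Import measurable_realfun ring.
Set Implicit Arguments.
Unset Strict Implicit.
Unset Printing Implicit Defensive.
Import Order.TTheory GRing.Theory Num.Theory.
Import numFieldNormedType.Exports.
Local Open Scope classical_set_scope.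
Local Open Scope ring_scope.

(** The boundary case |z| = 1, in particular z = 1, shapes the argument: 1/(1-zu) may be unbounded
    near u = 1, and no ratio q < 1 bounds |zu| uniformly. An exact telescoping identity for the
    finite sums avoids both difficulties, since its remainder is dominated by the integrand itself,
    whose integrability is the hypothesis. Convergence of the series to the stated value then comes
    out of the integral. Tonelli asks for nonnegative integrands, so the reduction to one variable
    is made for nonnegative G, then for real G through its positive and negative parts, then for the
    real and imaginary parts of a complex G. The terms are Gamma integrals with a complex parameter
    c = a + k, computed from an explicit primitive. Re c > 0 makes that primitive vanish at 0; if Re
    a <= 0, the modulus of u^(a-1) (-log u)^(s-1) is at least (-log u)^(s-1) / u, which is not
    integrable at 0. *)

Local Notation mu := lebesgue_measure.

(** * Reciprocal, scaling and logarithmic integrals on the real line *)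

(** Writing [x^-1] as [x * expR (- ln (x ^+ 2))] exhibits it as a product and composition of
    measurable functions; at 0 the factor [x] reproduces the convention [0^-1 = 0]. *)
Lemma measurable_inv (R : realType) : measurable_fun [set: R] (@GRing.inv R).
Proof.
have -> : @GRing.inv R = fun x => x * expR (- ln (x ^+ 2)).
  apply/funext => x; have [->|x0] := eqVneq x 0; first by rewrite invr0 mul0r.
  rewrite expRN lnK ?posrE ?exprn_even_gt0//.
  by rewrite expr2 invfM mulrA divff// mul1r.
apply: measurable_funM => //; apply: measurableT_comp => //.
apply: measurableT_comp => //; apply: measurableT_comp; first exact: measurable_ln.
exact: exprn_measurable.
Qed.

(** Lebesgue measure is [y] times its push-forward under multiplication by [y]: the two agree on
    half-open intervals, hence everywhere by uniqueness. *)
Lemma ge0_integral_scale (R : realType) (y : R) (f : R -> \bar R) : 0 < y ->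
  measurable_fun setT f -> (forall x, (0 <= f x)%E) ->
  (\int[mu]_x f (x * y)%R =
   (y^-1)%:E * \int[mu]_x f x)%E.
Proof.
move=> y0 mf f0.
have mphi : measurable_fun setT ((fun x => x * y) : measurableTypeR R -> measurableTypeR R).
  exact: mulrr_measurable.
have yi0 : 0 <= y^-1 by rewrite invr_ge0 ltW.
pose nu := mscale (NngNum (ltW y0)) (pushforward lebesgue_measure ((fun x => x * y) : measurableTypeR R -> measurableTypeR R)).
have E A : measurable A -> lebesgue_measure A = nu mphi A.
  apply: lebesgue_measure_unique => _ [[a b]] _ <-.
  have preE : (fun x : measurableTypeR R => x * y : measurableTypeR R)
      @^-1` `]a, b] = `]a / y, b / y]%classic.
    by apply/seteqP; split => x /=; rewrite !in_itv /= ltr_pdivrMr// ler_pdivlMr.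
  transitivity (y%:E * lebesgue_measure `](a / y)%R, (b / y)%R])%E; last by rewrite -preE.
  rewrite !lebesgue_measure_itv /= !lte_fin ltr_pM2r ?invr_gt0//.
  case: ifPn => ab; last by rewrite mule0.
  by rewrite -!EFinD -EFinM; congr EFin; field; rewrite gt_eqF.
rewrite [in RHS](@eq_measure_integral _ _ _ setT (nu mphi) lebesgue_measure); last first.
  by move=> A mA _; exact: E.
rewrite ge0_integral_mscale//= muleA -EFinM mulVf ?gt_eqF// mul1e.
by apply/esym; apply: ge0_integral_pushforward.
Qed.

Lemma is_derive_Nln_exp (R : realType) (n : nat) (y : R) : 0 < y ->
  is_derive y 1 (fun y : R => - ((- ln y) ^+ n.+1 / n.+1%:R)) ((- ln y) ^+ n / y).
Proof.
move=> y0.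
have dl : is_derive y 1 (fun y : R => - ln y) (- y^-1).
  exact: (is_deriveN (is_derive1_ln y0)).
have H : is_derive y 1 (fun y : R => - ((- ln y) ^+ n.+1 / n.+1%:R))
  (- (n.+1%:R^-1 * (n.+1%:R * (- ln y) ^+ n * - y^-1))).
  have -> : (fun y : R => - ((- ln y) ^+ n.+1 / n.+1%:R)) =
    (fun y : R => - (n.+1%:R^-1 *: (((fun y : R => - ln y) ^+ n.+1) : R -> R) y)).
    by apply/funext => t; rewrite /GRing.scale /= exprfctE mulrC.
  apply: is_deriveN; apply: is_deriveZ; apply: is_derive_eq.
  by rewrite /GRing.scale /= mulr_natl.
apply: is_derive_eq H _.
by field; rewrite gt_eqF//= pnatr_eq0.
Qed.

(** Requiring the derivative at both endpoints yields the one-sided continuity of [F] that the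
    fundamental theorem asks for. *)
Lemma derivable_FTC2 (R : realType) (f F : R -> R) (a b : R) : a < b ->
  (forall x, a <= x <= b -> {for x, continuous f}) ->
  (forall x, a <= x <= b -> is_derive x 1 F (f x)) ->
  (\int[mu]_(x in `[a, b]) (f x)%:E = (F b)%:E - (F a)%:E)%E.
Proof.
move=> ab cf dF.
have cF x : a <= x <= b -> {for x, continuous F}.
  move=> xab; apply: differentiable_continuous; apply/derivable1_diffP.
  by have := dF x xab => -[].
apply: continuous_FTC2 => //.
- apply: continuous_in_subspaceT => x; rewrite inE/= in_itv/=; exact: cf.
- split.
  + move=> x; rewrite in_itv/= => /andP[ax xb].
    by have [] : is_derive x 1 F (f x) by apply: dF; rewrite !ltW.
  + by apply: cvg_at_right_filter; apply: cF; rewrite lexx ltW.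
  + by apply: cvg_at_left_filter; apply: cF; rewrite lexx ltW.
- move=> x; rewrite in_itv/= => /andP[ax xb].
  rewrite derive1E; have H : is_derive x 1 F (f x) by apply: dF; rewrite !ltW.
  by rewrite derive_val.
Qed.

Lemma integral_Nln_exp_div (R : realType) (n : nat) (u : R) : 0 < u < 1 ->
  (\int[mu]_(y in `]u, 1%R[) ((- ln y) ^+ n / y)%:E =
   ((- ln u) ^+ n.+1 / n.+1%:R)%:E)%E.
Proof.
move=> /andP[u0 u1].
have c x : u <= x <= 1 -> {for x, continuous (fun y : R => (- ln y) ^+ n / y)}.
  move=> /andP[ux _]; have x0 : 0 < x by exact: lt_le_trans ux.
  apply: cvgM; last by apply: cvgV; [rewrite gt_eqF|exact: cvg_id].
  apply: (@continuous_comp _ _ _ (fun y : R => - ln y) (fun z => z ^+ n)); last exact: exprn_continuous.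
  by apply: cvgN; apply: continuous_ln.
rewrite -(@integral_itv_bndoo _ _ _ _ true false).
  have d x : u <= x <= 1 ->
      is_derive x 1 (fun y : R => - ((- ln y) ^+ n.+1 / n.+1%:R)) ((- ln x) ^+ n / x).
    by move=> /andP[ux _]; apply: is_derive_Nln_exp; exact: lt_le_trans ux.
  rewrite (derivable_FTC2 u1 c d).
  by rewrite ln1 oppr0 expr0n /= mul0r oppr0 -EFinB opprK add0r.
apply/measurable_EFinP; apply: measurable_funTS; apply: measurable_funM.
  apply: measurable_funX; apply: measurable_funN; exact: measurable_ln.
exact: measurable_inv.
Qed.

(** * Reduction of the integral over the square to one variable *)

(** For fixed [y] the substitution [u = x * y] maps the square onto the triangle [0 < u < y < 1];
    integrating over [y] in []u, 1[] first then leaves the logarithmic weight. *)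
Lemma integral_square_ge0 (R : realType) (n : nat) (G : R -> R) :
  measurable_fun setT G -> (forall u, 0 <= G u) ->
  (\int[@leb2 R]_(p in @unit_square R) (G (p.1 * p.2) * (- ln p.2) ^+ n)%:E =
   \int[mu]_(u in `]0%R, 1%R[) (G u * ((- ln u) ^+ n.+1 / n.+1%:R))%:E)%E.
Proof.
move=> mG G0.
have w0 m (y : R) : y < 1 -> 0 <= (- ln y) ^+ m.
  by move=> y1; rewrite exprn_ge0// oppr_ge0 ln_le0// ltW.
have mln m : measurable_fun setT (fun y : R => (- ln y) ^+ m).
  by apply: measurable_funX; apply: measurable_funN; exact: measurable_ln.
(* [K] is the integrand and [L] its transform, with Jacobian [1 / y]; both are extended by zero so
   that Tonelli and the scaling apply on the whole plane and line. *)
pose K (p : R * R) : R := if (0 < p.1 < 1) && (0 < p.2 < 1)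
  then G (p.1 * p.2) * (- ln p.2) ^+ n else 0.
pose L (p : R * R) : R := if (0 < p.1 < p.2) && (p.2 < 1)
  then G p.1 * ((- ln p.2) ^+ n / p.2) else 0.
have K0 p : 0 <= K p.
  by rewrite /K; case: ifPn => // /and3P[_ _ p1]; rewrite mulr_ge0// w0.
have L0 p : 0 <= L p.
  rewrite /L; case: ifPn => // /andP[/andP[p1 p12] p2].
  by rewrite mulr_ge0// divr_ge0 ?w0// ltW// (lt_trans p1).
have m1 : measurable_fun setT (fun p : R * R => p.1) by exact: measurable_fst.
have m2 : measurable_fun setT (fun p : R * R => p.2) by exact: measurable_snd.
have mK : measurable_fun setT K.
  apply: measurable_fun_ifT => //.
    by do ?apply: measurable_and; apply: measurable_fun_ltr.
  apply: measurable_funM; first by apply: measurableT_comp => //; exact: measurable_funM.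
  exact: (measurableT_comp (mln n) m2).
have mL : measurable_fun setT L.
  apply: measurable_fun_ifT => //.
    by do ?apply: measurable_and; apply: measurable_fun_ltr.
  apply: measurable_funM; first exact: measurableT_comp.
  apply: measurable_funM; first exact: (measurableT_comp (mln n) m2).
  by apply: measurableT_comp => //; exact: measurable_inv.
transitivity (\int[@leb2 R]_p (K p)%:E)%E.
  rewrite integral_mkcond; apply: eq_integral => -[x y] _.
  rewrite patchE /K /=; case: ifPn => h.
    move: h; rewrite inE /unit_square /= !in_itv /= => -[hx hy].
    by rewrite hx hy.
  case: ifPn => // /andP[hx hy]; exfalso; move/negP: h; apply.
  by rewrite inE /unit_square /= !in_itv.
rewrite /leb2 fubini_tonelli2//; last exact/measurable_EFinP.
transitivity (\int[mu]_y \int[mu]_u (L (u, y))%:E)%E.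
  apply: eq_integral => y _; rewrite /fubini_G.
  have [/andP[y0 y1]|y01] := boolP (0 < y < 1); last first.
    rewrite integral0_eq => [|x _]; last by rewrite /K /= (negbTE y01) andbF.
    rewrite integral0_eq => [//|x _]; rewrite /L /=.
    case: ifPn => // /andP[/andP[x0 xy] y1].
    by move: y01; rewrite y1 (lt_trans x0 xy).
  (* Here [K (x, y) = y * L (x * y, y)], and this factor [y] cancels the [y^-1] produced by the
     scaling. *)
  transitivity (\int[mu]_x (fun u => y%:E * (L (u, y))%:E) (x * y)%R)%E.
    apply: eq_integral => x _; rewrite /K /L /= y0 y1 !andbT -EFinM; congr EFin.
    have -> : (x * y < y) = (x < 1) by rewrite -[X in _ < X]mul1r ltr_pM2r.
    rewrite pmulr_lgt0//.
    by case: ifPn; rewrite ?mulr0// => _; field; rewrite gt_eqF.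
  have mLy : measurable_fun setT (fun u => (L (u, y))%:E).
    by apply/measurable_EFinP; apply: measurableT_comp.
  rewrite (@ge0_integral_scale _ y (fun u => y%:E * (L (u, y))%:E)%E)//; last 2 first.
    by apply: emeasurable_funM.
    by move=> x; rewrite -EFinM lee_fin mulr_ge0// ltW.
  rewrite ge0_integralZl//; last 2 first.
    by move=> x _; rewrite lee_fin.
    by rewrite lee_fin ltW.
  by rewrite muleA -EFinM mulVf ?gt_eqF// mul1e.
transitivity (\int[mu]_u \int[mu]_y (L (u, y))%:E)%E.
  apply/esym; apply: (@fubini_tonelli _ _ _ _ R mu mu (EFin \o L)).
    exact/measurable_EFinP.
  by move=> p; rewrite lee_fin.
rewrite [RHS]integral_mkcond; apply: eq_integral => u _; rewrite patchE.
case: ifPn => hu; last first.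
  rewrite integral0_eq => [//|y _]; rewrite /L /=.
  case: ifPn => // /andP[/andP[x0 xy] y1]; exfalso; move/negP: hu; apply.
  by rewrite inE/= in_itv/= x0 (lt_trans xy).
move: hu; rewrite inE/= in_itv/= => /andP[u0 u1].
rewrite EFinM -integral_Nln_exp_div ?u0// -ge0_integralZl//; last 3 first.
- apply/measurable_EFinP; apply: measurable_funTS; apply: measurable_funM.
    exact: mln.
  exact: measurable_inv.
- move=> y; rewrite /= in_itv/= => /andP[uy y1].
  by rewrite lee_fin divr_ge0 ?w0// ltW// (lt_trans u0).
- by rewrite lee_fin.
rewrite [RHS]integral_mkcond; apply: eq_integral => y _; rewrite patchE.
rewrite /L /= u0 /=; case: ifPn => h.
  by rewrite mem_set ?EFinM//= in_itv.
by rewrite memNset//= in_itv/=; apply/negP.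
Qed.

(** The weights are nonnegative on []0, 1[], so the absolute value and the positive and negative
    parts of the integrand are those of [G] times the weight. The nonnegative case for [|G|]
    transfers integrability, and for the two parts of [G] it transfers the value. *)
Lemma integral_square (R : realType) (n : nat) (G : R -> R) :
  measurable_fun setT G ->
  (@leb2 R).-integrable (@unit_square R)
    (EFin \o (fun p => G (p.1 * p.2) * (- ln p.2) ^+ n)) ->
  mu.-integrable `]0%R, 1%R[
    (EFin \o (fun u => G u * ((- ln u) ^+ n.+1 / n.+1%:R))) /\
  Rintegral (@leb2 R) (@unit_square R) (fun p => G (p.1 * p.2) * (- ln p.2) ^+ n) =
  Rintegral mu `]0%R, 1%R[ (fun u => G u * ((- ln u) ^+ n.+1 / n.+1%:R)).
Proof.
move=> mG /integrableP[_ iG].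
have w0 m (y : R) : y < 1 -> 0 <= (- ln y) ^+ m.
  by move=> y1; rewrite exprn_ge0// oppr_ge0 ln_le0// ltW.
have mln m : measurable_fun setT (fun y : R => (- ln y) ^+ m).
  by apply: measurable_funX; apply: measurable_funN; exact: measurable_ln.
split.
  apply/integrableP; split.
    apply/measurable_EFinP; apply: measurable_funTS; apply: measurable_funM => //.
    by apply: measurable_funM => //; exact: mln.
  move: iG; rewrite [X in (X < _)%E](_ : _ =
    \int[@leb2 R]_(p in @unit_square R) ((Num.norm \o G) (p.1 * p.2) * (- ln p.2) ^+ n)%:E)%E.
    rewrite integral_square_ge0//; last 2 first.
      rewrite (_ : _ \o _ = fun u => Num.max (G u) (- G u)).
        by apply: measurable_maxr => //; exact: measurable_funN.
      by apply/funext => u /=; rewrite maxrN.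
      by move=> u /=.
    congr (_ < _)%E; apply: eq_integral => u; rewrite inE/= in_itv/= => /andP[u0 u1].
    have h : 0 <= (- ln u) ^+ n.+1 / n.+1%:R by rewrite divr_ge0// w0.
    by rewrite normrM (ger0_norm h).
  apply: eq_integral => -[x y]; rewrite inE /unit_square /= !in_itv /= => -[_ /andP[y0 y1]].
  by rewrite normrM [X in _ * X]ger0_norm// w0.
rewrite /Rintegral; congr fine; rewrite [LHS]integralE [RHS]integralE; congr (_ - _)%E.
- transitivity (\int[@leb2 R]_(p in @unit_square R) (G^\+ (p.1 * p.2)%R * (- ln p.2) ^+ n)%:E)%E.
    apply: eq_integral => -[x y]; rewrite inE /unit_square /= !in_itv /= => -[_ /andP[y0 y1]].
    rewrite funeposE /= -EFin_max; congr EFin.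
    by rewrite /funrpos maxr_pMl ?mul0r// w0.
  rewrite integral_square_ge0//; last exact: measurable_funrpos.
  apply: eq_integral => u; rewrite inE/= in_itv/= => /andP[u0 u1].
  rewrite funeposE /= -EFin_max; congr EFin.
  by rewrite /funrpos maxr_pMl ?mul0r// divr_ge0// w0.
- transitivity (\int[@leb2 R]_(p in @unit_square R) (G^\- (p.1 * p.2)%R * (- ln p.2) ^+ n)%:E)%E.
    apply: eq_integral => -[x y]; rewrite inE /unit_square /= !in_itv /= => -[_ /andP[y0 y1]].
    rewrite funenegE /= -EFin_max; congr EFin.
    by rewrite /funrneg maxr_pMl ?mul0r ?mulNr// w0.
  rewrite integral_square_ge0//; last exact: measurable_funrneg.
  apply: eq_integral => u; rewrite inE/= in_itv/= => /andP[u0 u1].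
  rewrite funenegE /= -EFin_max; congr EFin.
  by rewrite /funrneg maxr_pMl ?mul0r ?mulNr// divr_ge0// w0.
Qed.

(** * Complex-valued functions of a real variable, handled componentwise *)

Local Open Scope complex_scope.
Local Notation Re := complex.Re.
Local Notation Im := complex.Im.
Local Notation normc := Normc.normc.

Lemma complex_ReM (R : realType) (x y : R[i]) : Re (x * y) = Re x * Re y - Im x * Im y.
Proof. by case: x y => a b [c d]. Qed.

Lemma complex_ImM (R : realType) (x y : R[i]) : Im (x * y) = Re x * Im y + Im x * Re y.
Proof. by case: x y => a b [c d]. Qed.

Lemma complex_ReD (R : realType) (x y : R[i]) : Re (x + y) = Re x + Re y.
Proof. by case: x y => a b [c d]. Qed.

Lemma complex_ImD (R : realType) (x y : R[i]) : Im (x + y) = Im x + Im y.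
Proof. by case: x y => a b [c d]. Qed.

Lemma complex_ReV (R : realType) (x : R[i]) :
  Re x^-1 = Re x / (Re x ^+ 2 + Im x ^+ 2).
Proof. by case: x. Qed.

Lemma complex_ImV (R : realType) (x : R[i]) :
  Im x^-1 = - (Im x / (Re x ^+ 2 + Im x ^+ 2)).
Proof. by case: x. Qed.

Lemma normc_ge0 (R : realType) (x : R[i]) : 0 <= normc x.
Proof. by case: x => a b; exact: sqrtr_ge0. Qed.

Lemma ler_Re_normc (R : realType) (x : R[i]) : `|Re x| <= normc x.
Proof. by case: x => a b /=; rewrite -sqrtr_sqr ler_wsqrtr// lerDl sqr_ge0. Qed.

Lemma ler_Im_normc (R : realType) (x : R[i]) : `|Im x| <= normc x.
Proof. by case: x => a b /=; rewrite -sqrtr_sqr ler_wsqrtr// lerDr sqr_ge0. Qed.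

Lemma normc_real (R : realType) (r : R) : normc r%:C = `|r|.
Proof. by rewrite /normc /= expr0n/= addr0 sqrtr_sqr. Qed.

Lemma normcX (R : realType) (x : R[i]) n : normc (x ^+ n) = normc x ^+ n.
Proof.
by elim: n => [|n IH]; [exact: Normc.normc1|rewrite !exprS Normc.normcM IH].
Qed.

Lemma normc_le_add (R : realType) (x : R[i]) : normc x <= `|Re x| + `|Im x|.
Proof.
have {1}-> : x = (Re x)%:C + 'i * (Im x)%:C by exact: complexE.
apply: le_trans (le_normcD _ _) _.
by rewrite Normc.normcM !normc_real /normc /= expr0n/= expr1n add0r sqrtr1 mul1r.
Qed.

(** Measurability is taken on the whole line because the reduction to one variable composes [G] with
    the product [x * y] on the whole plane. *)
Definition cmeasurable (R : realType) (f : R -> R[i]) : Prop :=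
  measurable_fun setT (fun u => Re (f u)) /\ measurable_fun setT (fun u => Im (f u)).

Lemma cmeasurable_cst (R : realType) (c : R[i]) : cmeasurable (fun _ : R => c).
Proof. by []. Qed.

Lemma cmeasurable_real (R : realType) (f : R -> R) :
  measurable_fun setT f -> cmeasurable (fun u => (f u)%:C).
Proof. by []. Qed.

Lemma cmeasurableD (R : realType) (f g : R -> R[i]) :
  cmeasurable f -> cmeasurable g -> cmeasurable (fun u => f u + g u).
Proof.
move=> [fr fi] [gr gi]; split.
  by under eq_fun do rewrite complex_ReD; exact: measurable_funD.
by under eq_fun do rewrite complex_ImD; exact: measurable_funD.
Qed.

Lemma cmeasurableM (R : realType) (f g : R -> R[i]) :
  cmeasurable f -> cmeasurable g -> cmeasurable (fun u => f u * g u).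
Proof.
move=> [fr fi] [gr gi]; split.
  by under eq_fun do rewrite complex_ReM; apply: measurable_funB; exact: measurable_funM.
by under eq_fun do rewrite complex_ImM; apply: measurable_funD; exact: measurable_funM.
Qed.

Lemma cmeasurableX (R : realType) (f : R -> R[i]) n :
  cmeasurable f -> cmeasurable (fun u => f u ^+ n).
Proof.
move=> mf; elim: n => [|n IH]; first exact: (@cmeasurable_cst R 1).
by under eq_fun do rewrite exprS; exact: cmeasurableM.
Qed.

Lemma cmeasurableV (R : realType) (f : R -> R[i]) :
  cmeasurable f -> cmeasurable (fun u => (f u)^-1).
Proof.
move=> [fr fi].
have mn : measurable_fun setT (fun u => (Re (f u) ^+ 2 + Im (f u) ^+ 2)^-1).
  apply: measurableT_comp; first exact: measurable_inv.
  by apply: measurable_funD; exact: measurable_funX.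
split.
  by under eq_fun do rewrite complex_ReV; exact: measurable_funM.
under eq_fun do rewrite complex_ImV; apply: measurable_funN; exact: measurable_funM.
Qed.

Lemma cmeasurable_cpowR (R : realType) (w : R[i]) : cmeasurable (fun u : R => cpowR u w).
Proof.
have ml (r : R) : measurable_fun setT (fun u => r * ln u).
  by apply: measurable_funM => //; exact: measurable_ln.
apply: cmeasurableM; first by apply: cmeasurable_real; exact: (measurableT_comp (@measurable_expR R)).
split; apply: measurableT_comp (ml _).
  by apply: continuous_measurable_fun; exact: continuous_cos.
by apply: continuous_measurable_fun; exact: continuous_sin.
Qed.

Lemma normc_cpowR (R : realType) (u : R) (w : R[i]) :
  normc (cpowR u w) = expR (Re w * ln u).
Proof.
rewrite /cpowR Normc.normcM normc_real /= cos2Dsin2 sqrtr1 mulr1.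
by rewrite ger0_norm// expR_ge0.
Qed.

Lemma cpowRD1 (R : realType) (u : R) (w : R[i]) : 0 < u ->
  cpowR u (w + 1) = cpowR u w * u%:C.
Proof.
move=> u0; rewrite /cpowR; case: w => r i /=; rewrite addr0 mulrDl mul1r expRD.
by rewrite lnK ?posrE// rmorphM /= mulrAC.
Qed.

Lemma cpowR1 (R : realType) (w : R[i]) : cpowR 1 w = 1.
Proof. by rewrite /cpowR ln1 !mulr0 expR0 cos0 sin0 mul1r. Qed.

Definition cderive (R : realType) (f : R -> R[i]) (u : R) (l : R[i]) : Prop :=
  is_derive u 1 (fun x => Re (f x)) (Re l) /\ is_derive u 1 (fun x => Im (f x)) (Im l).

Lemma cderive_cst (R : realType) (c : R[i]) (u : R) : cderive (fun=> c) u 0.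
Proof. by split; exact: is_derive_cst. Qed.

Lemma cderive_real (R : realType) (f : R -> R) (u l : R) :
  is_derive u 1 f l -> cderive (fun x => (f x)%:C) u l%:C.
Proof. by move=> fl; split => //; exact: is_derive_cst. Qed.

Lemma cderiveD (R : realType) (f g : R -> R[i]) (u : R) (l m : R[i]) :
  cderive f u l -> cderive g u m -> cderive (fun x => f x + g x) u (l + m).
Proof.
move=> [fr fi] [gr gi]; split.
  rewrite complex_ReD; under eq_fun do rewrite complex_ReD; exact: is_deriveD.
rewrite complex_ImD; under eq_fun do rewrite complex_ImD; exact: is_deriveD.
Qed.

Lemma cderiveM (R : realType) (f g : R -> R[i]) (u : R) (l m : R[i]) :
  cderive f u l -> cderive g u m ->
  cderive (fun x => f x * g x) u (l * g u + f u * m).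
Proof.
move=> [fr fi] [gr gi]; split.
  rewrite complex_ReD !complex_ReM; under eq_fun do rewrite complex_ReM.
  apply: (is_derive_eq (is_deriveB (is_deriveM fr gr) (is_deriveM fi gi))).
  by rewrite /GRing.scale /=; ring.
rewrite complex_ImD !complex_ImM; under eq_fun do rewrite complex_ImM.
apply: (is_derive_eq (is_deriveD (is_deriveM fr gi) (is_deriveM fi gr))).
by rewrite /GRing.scale /=; ring.
Qed.

Lemma cderive_eq (R : realType) (f : R -> R[i]) (u : R) (l m : R[i]) :
  cderive f u l -> l = m -> cderive f u m.
Proof. by move=> ? <-. Qed.

Lemma cderive_cpowR (R : realType) (c : R[i]) (u : R) : 0 < u ->
  cderive (fun x => cpowR x c) u (c * cpowR u (c - 1)).
Proof.
move=> u0.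
have dl (r : R) : is_derive u 1 (fun x => r * ln x) (r / u).
  exact: (is_deriveZ r (is_derive1_ln u0)).
have de : is_derive u 1 (fun x => expR (Re c * ln x)) (expR (Re c * ln u) * (Re c / u)).
  exact: (is_derive1_comp (is_derive_expR _) (dl _)).
have dc : is_derive u 1 (fun x => cos (Im c * ln x)) (- sin (Im c * ln u) * (Im c / u)).
  exact: (is_derive1_comp (is_derive_cos _) (dl _)).
have ds : is_derive u 1 (fun x => sin (Im c * ln x)) (cos (Im c * ln u) * (Im c / u)).
  exact: (is_derive1_comp (is_derive_sin _) (dl _)).
have dcs : cderive (fun x => cos (Im c * ln x) +i* sin (Im c * ln x)) u
  ((- sin (Im c * ln u) * (Im c / u)) +i* (cos (Im c * ln u) * (Im c / u))) by [].
apply: cderive_eq (cderiveM (cderive_real de) dcs) _.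
(* Through [u^(c-1) = u^c / u] both sides involve the same exponential, cosine and sine, and the
   claim becomes a polynomial identity in these and [1 / u]. *)
have -> : c * cpowR u (c - 1) = c * cpowR u c * (u^-1)%:C.
  rewrite -{4}(subrK 1 c) cpowRD1// -!mulrA -rmorphM /= divff ?gt_eqF//.
  by rewrite rmorph1 mulr1.
rewrite /cpowR; move: (expR _) (cos _) (sin _) => e C S; clear.
by case: c => a b /=; apply/eqP; rewrite eq_complex /=; apply/andP; split; apply/eqP; ring.
Qed.

(** * Complex integrals over the unit interval *)

Definition cintegrable01 (R : realType) (f : R -> R[i]) : Prop :=
  mu.-integrable `]0%R, 1%R[ (EFin \o (fun u => Re (f u))) /\
  mu.-integrable `]0%R, 1%R[ (EFin \o (fun u => Im (f u))).

Definition cintegral01 (R : realType) (f : R -> R[i]) : R[i] :=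
  (\int[mu]_(u in `]0%R, 1%R[) Re (f u)) +i* (\int[mu]_(u in `]0%R, 1%R[) Im (f u)).

Lemma eq_cintegrable01 (R : realType) (f g : R -> R[i]) :
  (forall u, 0 < u < 1 -> f u = g u) -> cintegrable01 f -> cintegrable01 g.
Proof.
move=> fg [fr fi]; split; [apply: eq_integrable fr => //|apply: eq_integrable fi => //];
by move=> u; rewrite inE/= in_itv/= => u01; rewrite fg.
Qed.

Lemma eq_cintegral01 (R : realType) (f g : R -> R[i]) :
  (forall u, 0 < u < 1 -> f u = g u) -> cintegral01 f = cintegral01 g.
Proof.
move=> fg; congr (_ +i* _); apply: eq_Rintegral => u;
by rewrite inE/= in_itv/= => u01; rewrite fg.
Qed.

(** This sum serves as dominating function in place of the modulus: it bounds the modulus and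
    inherits integrability directly from the components. *)
Lemma integrable01_norm (R : realType) (f : R -> R[i]) : cintegrable01 f ->
  mu.-integrable `]0%R, 1%R[ (EFin \o (fun u => `|Re (f u)| + `|Im (f u)|)).
Proof.
move=> [fr fi].
rewrite (_ : _ \o _ = (EFin \o (fun u => `|Re (f u)|%R)) \+ (EFin \o (fun u => `|Im (f u)|%R)))%E//.
by apply: integrableD => //; apply: integrable_norm.
Qed.

Lemma cintegrable01_le (R : realType) (f g : R -> R[i]) (M : R) : 0 <= M ->
  cintegrable01 f -> cmeasurable g ->
  (forall u, 0 < u < 1 -> normc (g u) <= M * normc (f u)) -> cintegrable01 g.
Proof.
move=> M0 /integrable01_norm fi [gr gi] gf.
have iM : mu.-integrable `]0%R, 1%R[
    (fun u => M%:E * (EFin \o (fun u => `|Re (f u)|%R + `|Im (f u)|%R)%R) u)%E.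
  exact: integrableZl.
have bnd u : 0 < u < 1 -> normc (g u) <= `|M * (`|Re (f u)| + `|Im (f u)|)|.
  move=> u01; rewrite ger0_norm ?mulr_ge0 ?addr_ge0//.
  by apply: le_trans (gf _ u01) _; rewrite ler_wpM2l// normc_le_add.
split; apply: le_integrable iM => //.
- by apply/measurable_EFinP; exact: measurable_funTS.
- move=> u /=; rewrite in_itv/= => u01; rewrite lee_fin.
  by apply: le_trans (bnd _ u01); exact: ler_Re_normc.
- by apply/measurable_EFinP; exact: measurable_funTS.
- move=> u /=; rewrite in_itv/= => u01; rewrite lee_fin.
  by apply: le_trans (bnd _ u01); exact: ler_Im_normc.
Qed.

Lemma cintegral01D (R : realType) (f g : R -> R[i]) :
  cintegrable01 f -> cintegrable01 g ->
  cintegral01 (fun u => f u + g u) = cintegral01 f + cintegral01 g.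
Proof.
move=> [fr fi] [gr gi]; rewrite /cintegral01.
under eq_Rintegral do rewrite complex_ReD.
rewrite RintegralD//.
under [X in _ +i* X]eq_Rintegral do rewrite complex_ImD.
by rewrite RintegralD.
Qed.

Lemma cintegral01Zl (R : realType) (c : R[i]) (f : R -> R[i]) :
  cintegrable01 f -> cintegral01 (fun u => c * f u) = c * cintegral01 f.
Proof.
move=> [fr fi]; rewrite /cintegral01.
have iZ (r : R) (h : R -> R) : mu.-integrable `]0%R, 1%R[ (EFin \o h) ->
    mu.-integrable `]0%R, 1%R[ (EFin \o (fun u => r * h u)).
  by move=> ih; exact: (@integrableZl _ _ _ _ _ _ r _ ih).
under eq_Rintegral do rewrite complex_ReM.
rewrite RintegralB//; [|exact: iZ..].
under [X in _ +i* X]eq_Rintegral do rewrite complex_ImM.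
rewrite RintegralD//; [|exact: iZ..].
by rewrite !RintegralZl//; case: c.
Qed.

(* The points [expR (- n)] make [ln] exact at the left end of the interval. *)
Lemma cvg_integral_expRN (R : realType) (f : R -> R) :
  mu.-integrable `]0%R, 1%R[ (EFin \o f) ->
  (\int[mu]_(x in `[expR (- n%:R), 1%R]) (f x)%:E)%E @[n --> \oo] -->
  (\int[mu]_(x in `]0%R, 1%R[) (f x)%:E)%E.
Proof.
move=> fi; have /integrableP[mf _] := fi.
pose D : set (measurableTypeR R) := `]0%R, 1%R[%classic.
have mD : measurable D by exact: measurable_itv.
have mf_ n : measurable_fun D ((EFin \o f) \_ `[expR (- n%:R), 1%R]).
  apply/measurable_restrict => //.
  exact: (measurable_funS mD (@subIsetl _ _ _) mf).
have f_f : {ae mu, forall x, D x ->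
    ((EFin \o f) \_ `[expR (- n%:R), 1%R]) x @[n --> \oo] --> (EFin \o f) x}.
  apply/aeW => x; rewrite /D /= in_itv/= => /andP[x0 x1].
  apply: cvg_near_cst; near=> n; rewrite patchE mem_set//= in_itv/= (ltW x1) andbT.
  rewrite -ler_ln ?posrE ?expR_gt0// expRK lerNl; near: n; exact: nbhs_infty_ger.
have f_g : {ae mu, forall x n, D x ->
    (`|((EFin \o f) \_ `[expR (- n%:R), 1%R]) x| <= `|(EFin \o f) x|)%E}.
  by apply/aeW => x n _; rewrite patchE; case: ifP => // _; rewrite abse0.
have [_ _] := dominated_convergence mD mf_ mf f_f (integrable_abse fi) f_g.
apply: cvg_trans; apply: near_eq_cvg; near=> n => /=.
rewrite /D -integral_mkcondr.
rewrite (_ : _ `&` _ = `[expR (- n%:R), 1%R[%classic); last first.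
  apply/seteqP; split => x /=; rewrite !in_itv/=.
    by move=> [/andP[_ ->] /andP[-> _]].
  move=> /andP[nx x1]; rewrite nx x1 (ltW x1) andbT; split => //.
  exact: lt_le_trans (expR_gt0 _) nx.
rewrite -integral_itv_bndo_bndc//; apply: measurable_funS mf => //.
move=> x /=; rewrite !in_itv/= => /andP[nx ->]; rewrite andbT.
exact: lt_le_trans (expR_gt0 _) nx.
Unshelve. all: by end_near. Qed.

(** * Gamma integrals with a complex parameter *)

(** A primitive of [u^(c-1) (- ln u)^m], built by repeated integration by parts. With [u = e^(-t)]
    the integral is that of [t^m e^(-c t)]; for complex [c], rescaling [t] by [c] is not a real
    change of variable, whereas the primitive works directly. *)
Fixpoint power_log_primitive (R : realType) (c : R[i]) (m : nat) (u : R) : R[i] :=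
  if m is p.+1
  then (cpowR u c * ((- ln u) ^+ m)%:C + m%:R * power_log_primitive c p u) / c
  else cpowR u c / c.

Lemma cderive_power_log_primitive (R : realType) (c : R[i]) m (u : R) :
  c != 0 -> 0 < u ->
  cderive (power_log_primitive c m) u (cpowR u (c - 1) * ((- ln u) ^+ m)%:C).
Proof.
move=> c0 u0; elim: m => [|m IH].
  apply: (cderive_eq (cderiveM (cderive_cpowR c u0) (cderive_cst c^-1 u))).
  by rewrite mulr0 addr0 mulrAC divff// mul1r expr0 mulr1.
have dl : is_derive u 1 (fun y : R => (- ln y) ^+ m.+1) (- (m.+1%:R * ((- ln u) ^+ m / u))).
  have H := is_deriveZ (- m.+1%:R) (is_derive_Nln_exp m u0).
  have -> : (fun y : R => (- ln y) ^+ m.+1) =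
      - m.+1%:R \*: (fun y : R => - ((- ln y) ^+ m.+1 / m.+1%:R)).
    apply/funext => y /=; rewrite /GRing.scale /= mulrNN mulrCA.
    by rewrite divff ?mulr1// pnatr_eq0.
  by apply: (is_derive_eq H); rewrite /GRing.scale /= mulNr.
have d1 := cderiveM (cderive_cpowR c u0) (cderive_real dl).
have d2 := cderiveM (cderive_cst m.+1%:R u) IH.
apply: (cderive_eq (cderiveM (cderiveD d1 d2) (cderive_cst c^-1 u))).
rewrite mul0r add0r mulr0 addr0.
have -> : cpowR u c = cpowR u (c - 1) * u%:C by rewrite -cpowRD1// subrK.
have -> : (- (m.+1%:R * ((- ln u) ^+ m / u)))%:C =
    - (m.+1%:R * ((- ln u) ^+ m)%:C / u%:C).
  by rewrite rmorphN !rmorphM /= fmorphV /= rmorph_nat mulrA.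
have u0' : u%:C != 0 :> R[i] by rewrite eq_complex /= gt_eqF.
by field; rewrite u0' c0.
Qed.

(** Since [ln 1 = 0], each step of the recursion multiplies the value at 1 by [m / c]. *)
Lemma power_log_primitive1 (R : realType) (c : R[i]) m :
  power_log_primitive c m 1 = m`!%:R / c ^+ m.+1.
Proof.
elim: m => [|m IH]; first by rewrite /= cpowR1 fact0.
rewrite /= -/(power_log_primitive c m 1) IH ln1 oppr0 expr0n /= mulr0 add0r.
by rewrite factS natrM [in RHS]exprSr invfM !mulrA.
Qed.

(** At [u = expR (- n)] the modulus of [u^c (- ln u)^k] is [e^(- n Re c) n^k], which tends to 0, and
    the primitive is a linear combination of such terms. *)
Lemma cvg_power_log_primitive0 (R : realType) (c : R[i]) m : 0 < Re c ->
  normc (power_log_primitive c m (expR (- n%:R))) @[n --> \oo] --> (0 : R).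
Proof.
move=> c0.
have key k : expR (- (Re c * n%:R)) * n%:R ^+ k @[n --> \oo] --> (0 : R).
  (* The bound comes from [e^x >= x^(k+1) / (k+1)!] at [x = n Re c]; the one power beyond [n^k]
     leaves a factor [1 / n]. *)
  have H : (k.+1)`!%:R / Re c ^+ k.+1 * (n%:R : R)^-1 @[n --> \oo] --> (0 : R).
    rewrite -[X in _ --> X](mulr0 ((k.+1)`!%:R / Re c ^+ k.+1)).
    apply: cvgM; first exact: cvg_cst.
    apply/gtr0_cvgV0; first by near=> n; rewrite ltr0n; near: n; exists 1%N.
    exact: cvgr_idn.
  apply: (squeeze_cvgr (f := fun=> 0) _ _ H); last exact: cvg_cst.
  near=> n.
  have n0 : 0 < (n%:R : R) by rewrite ltr0n; near: n; exists 1%N.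
  apply/andP; split; first by rewrite mulr_ge0 ?expR_ge0.
  rewrite expRN [X in X <= _]mulrC ler_pdivrMr ?expR_gt0//.
  have := expR_ge1Dxn k (mulr_ge0 (ltW c0) (ltW n0)).
  move=> h; have {h} : (Re c * n%:R) ^+ k.+1 / k.+1`!%:R <= expR (Re c * n%:R).
    by apply: le_trans h; rewrite lerDr.
  rewrite -(ler_pM2l (_ : 0 < k.+1`!%:R / Re c ^+ k.+1 * n%:R^-1)); last first.
    apply: mulr_gt0; last by rewrite invr_gt0.
    by apply: divr_gt0; [rewrite ltr0n fact_gt0|exact: exprn_gt0].
  apply: le_trans; rewrite le_eqVlt; apply/orP; left; apply/eqP.
  rewrite exprMn [n%:R ^+ k.+1]exprS; field.
  by rewrite !gt_eqF ?exprn_gt0// ltr0n fact_gt0.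
have nE k (n : nat) : normc (cpowR (expR (- n%:R)) c * ((- ln (expR (- n%:R))) ^+ k)%:C) =
    expR (- (Re c * n%:R)) * n%:R ^+ k.
  rewrite Normc.normcM normc_cpowR normc_real expRK opprK mulrN.
  by rewrite ger0_norm// exprn_ge0.
elim: m => [|m IH].
  have H : expR (- (Re c * n%:R)) * n%:R ^+ 0 * normc c^-1 @[n --> \oo] --> (0 : R).
    rewrite -[X in _ --> X](mul0r (normc c^-1)); apply: cvgM; last exact: cvg_cst.
    exact: key.
  apply: cvg_trans H; apply: near_eq_cvg; near=> n.
  by rewrite /= Normc.normcM normc_cpowR expRK mulrN expr0 mulr1.
have H : (expR (- (Re c * n%:R)) * n%:R ^+ m.+1 +
    m.+1%:R * normc (power_log_primitive c m (expR (- n%:R)))) * normc c^-1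
    @[n --> \oo] --> (0 : R).
  rewrite -[X in _ --> X](mul0r (normc c^-1)); apply: cvgM; last exact: cvg_cst.
  rewrite -[X in _ --> X](addr0 0); apply: cvgD; first exact: key.
  rewrite -[X in _ --> X](mulr0 m.+1%:R); apply: cvgM => //; exact: cvg_cst.
apply: (squeeze_cvgr (f := fun=> 0) _ _ H); last exact: cvg_cst.
near=> n; rewrite normc_ge0 /= Normc.normcM ler_wpM2r ?normc_ge0//.
apply: le_trans (le_normcD _ _) _.
rewrite nE lerD2l Normc.normcM.
have -> // : normc (m.+1%:R : R[i]) = m.+1%:R.
by rewrite -(rmorph_nat (real_complex R)) normc_real ger0_norm.
Unshelve. all: by end_near. Qed.

Lemma complex_ReMr (R : realType) (x : R[i]) (r : R) : Re (x * r%:C) = Re x * r.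
Proof. by rewrite complex_ReM /= mulr0 subr0. Qed.

Lemma complex_ImMr (R : realType) (x : R[i]) (r : R) : Im (x * r%:C) = Im x * r.
Proof. by rewrite complex_ImM /= mulr0 add0r. Qed.

(** Behaviour at 0 enters only through the limit of [F] along [expR (- n)], which is enough because
    the integrals over [[expR (- n), 1]] converge to the whole integral. *)
Lemma Rintegral01_primitive (R : realType) (f F : R -> R) :
  mu.-integrable `]0%R, 1%R[ (EFin \o f) ->
  (forall u : R, 0 < u -> {for u, continuous f}) ->
  (forall u : R, 0 < u -> is_derive u 1 F (f u)) ->
  F (expR (- n%:R)) @[n --> \oo] --> (0 : R) ->
  \int[mu]_(u in `]0%R, 1%R[) f u = F 1.
Proof.
move=> fi cf dF F0; rewrite /Rintegral.
suff -> : (\int[mu]_(u in `]0%R, 1%R[) (f u)%:E)%E = (F 1)%:E by [].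
have H1 := cvg_integral_expRN fi.
have H2 : (F 1 - F (expR (- n%:R)))%:E @[n --> \oo] --> (F 1)%:E.
  apply: cvg_EFin; first by near=> n.
  rewrite -[X in _ --> X]subr0; apply: cvgB => //; exact: cvg_cst.
have H3 : (\int[mu]_(x in `[expR (- n%:R), 1%R]) (f x)%:E)%E @[n --> \oo] --> (F 1)%:E.
  apply: cvg_trans H2; apply: near_eq_cvg; near=> n.
  have e1 : expR (- n%:R) < 1 :> R.
    by rewrite expR_lt1 oppr_lt0 ltr0n; near: n; exists 1%N.
  have pos x : expR (- n%:R) <= x <= 1 -> 0 < x.
    by move=> /andP[h _]; exact: lt_le_trans (expR_gt0 _) h.
  have c x : expR (- n%:R) <= x <= 1 -> {for x, continuous f}.
    by move=> /pos; exact: cf.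
  have d x : expR (- n%:R) <= x <= 1 -> is_derive x 1 F (f x).
    by move=> /pos; exact: dF.
  by rewrite (derivable_FTC2 e1 c d) EFinB.
exact: cvg_unique H1 H3.
Unshelve. all: by end_near. Qed.

Lemma cderive_continuous (R : realType) (f : R -> R[i]) (u : R) (l : R[i]) :
  cderive f u l -> {for u, continuous (fun x => Re (f x))} /\
                   {for u, continuous (fun x => Im (f x))}.
Proof.
by move=> [[dr _] [di _]]; split; apply: differentiable_continuous;
  exact/derivable1_diffP.
Qed.

Lemma cintegral01_power_log (R : realType) (c : R[i]) m : 0 < Re c ->
  cintegrable01 (fun u => cpowR u (c - 1) * ((- ln u) ^+ m)%:C) ->
  cintegral01 (fun u => cpowR u (c - 1) * ((- ln u) ^+ m)%:C) = m`!%:R / c ^+ m.+1.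
Proof.
move=> c0 [fr fi].
have cn0 : c != 0 by apply: contraTneq c0 => ->; rewrite ltxx.
have dF u : 0 < u -> cderive (power_log_primitive c m) u
    (cpowR u (c - 1) * ((- ln u) ^+ m)%:C).
  exact: cderive_power_log_primitive.
have cf u : 0 < u -> {for u, continuous (fun x : R => Re (cpowR x (c - 1) * ((- ln x) ^+ m)%:C))} /\
    {for u, continuous (fun x : R => Im (cpowR x (c - 1) * ((- ln x) ^+ m)%:C))}.
  move=> u0.
  have [cr ci] := cderive_continuous (cderive_cpowR (c - 1) u0).
  have cl : {for u, continuous (fun y : R => (- ln y) ^+ m)}.
    apply: (@continuous_comp _ _ _ (fun y : R => - ln y) (fun z => z ^+ m)).
      by apply: cvgN; apply: continuous_ln.
    exact: exprn_continuous.
  split.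
    rewrite (_ : (fun x => _) = (fun x => Re (cpowR x (c - 1)) * (- ln x) ^+ m)).
      exact: (cvgM cr cl).
    by apply/funext => x; rewrite complex_ReMr.
  rewrite (_ : (fun x => _) = (fun x => Im (cpowR x (c - 1)) * (- ln x) ^+ m)).
    exact: (cvgM ci cl).
  by apply/funext => x; rewrite complex_ImMr.
have F0 := cvg_power_log_primitive0 m c0.
have Fr0 : Re (power_log_primitive c m (expR (- n%:R))) @[n --> \oo] --> (0 : R).
  apply/norm_cvg0P; apply: (squeeze_cvgr (f := fun=> 0) _ _ F0); last exact: cvg_cst.
  by near=> n; rewrite normr_ge0 ler_Re_normc.
have Fi0 : Im (power_log_primitive c m (expR (- n%:R))) @[n --> \oo] --> (0 : R).
  apply/norm_cvg0P; apply: (squeeze_cvgr (f := fun=> 0) _ _ F0); last exact: cvg_cst.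
  by near=> n; rewrite normr_ge0 ler_Im_normc.
rewrite -power_log_primitive1 /cintegral01.
rewrite (Rintegral01_primitive fr (fun u u0 => (cf u u0).1) (fun u u0 => (dF u u0).1) Fr0).
rewrite (Rintegral01_primitive fi (fun u u0 => (cf u u0).2) (fun u u0 => (dF u u0).2) Fi0).
by case: power_log_primitive.
Unshelve. all: by end_near. Qed.

(** If [Re c <= 0], the modulus on []0, 1[] is at least [(- ln u)^m / u], whose integral from
    [expR (- n)] to 1 is [n^(m+1) / (m+1)], unbounded in [n]. *)
Lemma cintegrable01_power_log_gt0 (R : realType) (c : R[i]) m :
  cintegrable01 (fun u => cpowR u (c - 1) * ((- ln u) ^+ m)%:C) -> 0 < Re c.
Proof.
move=> ic; rewrite ltNge; apply/negP => c0.
have gi := integrable01_norm ic.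
set g := (fun u => _ + _) in gi.
have gM : (\int[mu]_(u in `]0%R, 1%R[) (EFin \o g) u)%E \is a fin_num.
  exact: integrable_fin_num.
pose M := fine (\int[mu]_(u in `]0%R, 1%R[) (g u)%:E)%E.
have /integrableP[mg _] := gi.
have wg u : 0 < u < 1 -> (- ln u) ^+ m / u <= g u.
  move=> /andP[u0 u1]; apply: le_trans (normc_le_add _).
  have l0 : 0 <= - ln u by rewrite oppr_ge0 ln_le0// ltW.
  rewrite Normc.normcM normc_cpowR normc_real ger0_norm ?exprn_ge0//.
  rewrite mulrC ler_wpM2r ?exprn_ge0//.
  (* With [u^-1] in exponential form the exponents can be compared; they differ by [Re c * ln u], a
     product of two nonpositive numbers. *)
  rewrite -[X in X <= _](@lnK _ u^-1) ?posrE ?invr_gt0// lnV ?posrE// ler_expR.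
  rewrite complex_ReD /= mulrBl mul1r lerDr.
  by rewrite -mulrNN mulr_ge0// oppr_ge0.
have bnd n : (0 < n)%N -> n%:R ^+ m.+1 / m.+1%:R <= M.
  move=> n0; rewrite -lee_fin /M fineK//.
  have e01 : 0 < expR (- n%:R : R) < 1 by rewrite expR_gt0 expR_lt1 oppr_lt0 ltr0n.
  have := integral_Nln_exp_div m e01; rewrite expRK opprK => <-.
  have sub : `]expR (- n%:R), 1%R[ `<=` (`]0%R, 1%R[ : set R).
    move=> x /=; rewrite !in_itv/= => /andP[h ->]; rewrite andbT.
    exact: lt_trans (expR_gt0 _) h.
  apply: (@le_trans _ _ (\int[mu]_(u in `]expR (- n%:R), 1%R[) (g u)%:E)%E).
    apply: ge0_le_integral => //.
    - move=> u /sub /=; rewrite in_itv/= => /andP[u0 u1]; rewrite lee_fin.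
      by rewrite divr_ge0 ?exprn_ge0 ?oppr_ge0 ?ln_le0 ?ltW.
    - apply/measurable_EFinP; apply: measurable_funTS; apply: measurable_funM.
        by apply: measurable_funX; apply: measurable_funN; exact: measurable_ln.
      exact: measurable_inv.
    - exact: measurable_funS mg.
    - by move=> u /sub /=; rewrite in_itv/= => u01; rewrite lee_fin wg.
  apply: ge0_subset_integral => //.
  by move=> u _; rewrite lee_fin /g addr_ge0.
(* The successor gives [N >= 1], hence [N^(m+1) >= N], while [N] exceeds [M (m+1)]. *)
pose N := (Num.bound (M * m.+1%:R)).+1.
have M0 : 0 <= M by apply: le_trans (bnd 1%N _); rewrite // expr1n divr_ge0.
have := bnd N isT; rewrite ler_pdivrMr ?ltr0n//; apply/negP; rewrite -ltNge.
apply: lt_le_trans (archi_boundP (mulr_ge0 M0 (ler0n _ _))) _.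
apply: (@le_trans _ _ N%:R); first by rewrite ler_nat.
by rewrite exprS ler_peMr// exprn_ege1// ler1n.
Qed.

(** * The Lerch series obtained from the integral *)

Lemma cpowRDn (R : realType) (u : R) (w : R[i]) n : 0 < u ->
  cpowR u (w + n%:R) = cpowR u w * (u%:C) ^+ n.
Proof.
move=> u0; elim: n => [|n IH]; first by rewrite addr0 mulr1.
by rewrite -natr1 addrA cpowRD1// IH exprSr mulrA.
Qed.

Lemma lerch_den_neq0 (R : realType) (z : R[i]) (u : R) : normc z <= 1 -> 0 < u < 1 ->
  1 - z * u%:C != 0.
Proof.
move=> z1 /andP[u0 u1]; rewrite subr_eq0; apply/eqP => h.
have : normc (z * u%:C) = 1 by rewrite -h Normc.normc1.
rewrite Normc.normcM normc_real gtr0_norm//; apply/eqP; rewrite lt_eqF//.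
by apply: le_lt_trans u1; rewrite ler_piMl// ltW.
Qed.

(** For each [u] in []0, 1[], [|z u| <= u < 1] gives pointwise decay even when |z| = 1, and the
    modulus of [f] dominates throughout. *)
Lemma cintegral01_geometric_cvg0 (R : realType) (z : R[i]) (f : R -> R[i]) :
  normc z <= 1 -> cmeasurable f -> cintegrable01 f ->
  Re (cintegral01 (fun u => (z * u%:C) ^+ n * f u)) @[n --> \oo] --> (0 : R) /\
  Im (cintegral01 (fun u => (z * u%:C) ^+ n * f u)) @[n --> \oo] --> (0 : R).
Proof.
move=> z1 mf fi.
pose D : set (measurableTypeR R) := `]0%R, 1%R[%classic.
have mD : measurable D by exact: measurable_itv.
have bnd n u : 0 < u < 1 -> normc ((z * u%:C) ^+ n * f u) <= u ^+ n * normc (f u).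
  move=> /andP[u0 u1]; rewrite Normc.normcM normcX Normc.normcM normc_real gtr0_norm//.
  rewrite ler_wpM2r ?normc_ge0// lerXn2r// ?nnegrE ?mulr_ge0 ?normc_ge0 ?(ltW u0)//.
  by rewrite ler_piMl// ltW.
have mg n : cmeasurable (fun u : R => (z * u%:C) ^+ n * f u).
  apply: cmeasurableM => //; apply: cmeasurableX; apply: cmeasurableM.
    exact: cmeasurable_cst.
  exact: cmeasurable_real.
(* [P] stands for [Re] or [Im], so that both components are treated at once. *)
have H (P : R[i] -> R) : (forall x, `|P x| <= normc x) ->
    (forall n, measurable_fun setT (fun u : R => P ((z * u%:C) ^+ n * f u))) ->
    (\int[mu]_(u in `]0%R, 1%R[) P ((z * u%:C) ^+ n * f u)) @[n --> \oo] --> (0 : R).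
  move=> hP mP.
  have mP_ n : measurable_fun D (EFin \o (fun u : R => P ((z * u%:C) ^+ n * f u))).
    by apply/measurable_EFinP; exact: measurable_funTS (mP n).
  have cvP : {ae mu, forall u, D u ->
      (EFin \o (fun u : R => P ((z * u%:C) ^+ n * f u))) u @[n --> \oo] --> (cst 0%E : R -> \bar R) u}.
    apply/aeW => u; rewrite /D /= in_itv/= => u01.
    apply: cvg_EFin; first exact: nearW.
    rewrite /=; apply/norm_cvg0P.
    have H0 : u ^+ n * normc (f u) @[n --> \oo] --> (0 : R).
      rewrite -[X in _ --> X](mul0r (normc (f u))); apply: cvgM; last exact: cvg_cst.
      by apply: cvg_expr; case/andP: u01 => u0 u1; rewrite gtr0_norm.
    apply: (squeeze_cvgr (f := fun=> 0) _ _ H0); last exact: cvg_cst.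
    near=> n; rewrite normr_ge0 /=; exact: le_trans (hP _) (bnd _ _ u01).
  have domP : {ae mu, forall u n, D u ->
      (`|(EFin \o (fun u : R => P ((z * u%:C) ^+ n * f u)%R)) u| <=
       (EFin \o (fun u => `|Re (f u)|%R + `|Im (f u)|%R)%R) u)%E}.
    apply/aeW => u n; rewrite /D /= in_itv/= => u01; rewrite lee_fin.
    apply: le_trans (hP _) _; apply: le_trans (bnd _ _ u01) _.
    apply: le_trans (normc_le_add _); rewrite ler_piMl ?normc_ge0//.
    by case/andP: u01 => u0 u1; rewrite exprn_ile1// ltW.
  have [_ _] := dominated_convergence mD mP_ (measurable_cst _) cvP (integrable01_norm fi) domP.
  rewrite integral0 => h.
  exact: (fine_cvg h).
split.
  by apply: (H _ (@ler_Re_normc R)) => n; case: (mg n).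
by apply: (H _ (@ler_Im_normc R)) => n; case: (mg n).
Unshelve. all: by end_near. Qed.

Lemma lerch_series01 (R : realType) (z a : R[i]) m : normc z <= 1 ->
  cintegrable01 (fun u => cpowR u (a - 1) * ((- ln u) ^+ m)%:C / (1 - z * u%:C)) ->
  cseries_to (lerch_term z m.+1 a)
    (cintegral01 (fun u => cpowR u (a - 1) * ((- ln u) ^+ m)%:C / (1 - z * u%:C)) / m`!%:R).
Proof.
set F := (fun u => _ / _) => z1 iF.
have mX n : cmeasurable (fun u : R => (z * u%:C) ^+ n).
  apply: cmeasurableX; apply: cmeasurableM; first exact: cmeasurable_cst.
  exact: cmeasurable_real.
have ml : cmeasurable (fun u : R => ((- ln u) ^+ m)%:C).
  apply: cmeasurable_real; apply: measurable_funX; apply: measurable_funN.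
  exact: measurable_ln.
have mF : cmeasurable F.
  apply: cmeasurableM; first by apply: cmeasurableM => //; exact: cmeasurable_cpowR.
  apply: cmeasurableV; apply: cmeasurableD; first exact: cmeasurable_cst.
  under eq_fun do rewrite -mulN1r.
  by apply: cmeasurableM; [exact: cmeasurable_cst|exact: (mX 1%N)].
(* [P k] is [F] without its denominator and with the exponent raised by [k]; its integral is the
   Gamma integral [m! / (k + a)^(m+1)]. *)
pose P k (u : R) : R[i] := cpowR u (k%:R + a - 1) * ((- ln u) ^+ m)%:C.
have PE k u : 0 < u < 1 -> P k u = (u%:C) ^+ k * (1 - z * u%:C) * F u.
  move=> u01; have /andP[u0 u1] := u01; rewrite /P /F.
  have -> : k%:R + a - 1 = a - 1 + k%:R by ring.
  by rewrite cpowRDn//; field; exact: lerch_den_neq0.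
(* The constant 2 bounds the modulus of [u^k (1 - z u)], the factor by which [P k] differs from
   [F]. *)
have iP k : cintegrable01 (P k).
  apply: (@cintegrable01_le _ F _ 2) => //.
    by apply: cmeasurableM => //; exact: cmeasurable_cpowR.
  move=> u u01; rewrite PE// Normc.normcM ler_wpM2r ?normc_ge0//.
  have /andP[u0 u1] := u01; rewrite Normc.normcM normcX normc_real gtr0_norm//.
  have h : normc (1 - z * u%:C) <= 2.
    apply: le_trans (le_normcD _ _) _.
    rewrite Normc.normc1 normcN Normc.normcM normc_real gtr0_norm//.
    have : normc z * u <= 1 by rewrite mulr_ile1 ?normc_ge0// ltW.
    by move=> h; rewrite -[2]/(1 + 1) lerD2l.
  by apply: le_trans h; rewrite ler_piMl ?normc_ge0// exprn_ile1// ltW.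
have a0 : 0 < Re a.
  have := iP 0%N; rewrite /P add0r; exact: cintegrable01_power_log_gt0.
have ak0 k : 0 < Re (k%:R + a).
  rewrite complex_ReD -(rmorph_nat (real_complex R)) /=.
  exact: ltr_wpDl (ler0n _ _) a0.
pose I n := cintegral01 (fun u => (z * u%:C) ^+ n * F u).
have iI n : cintegrable01 (fun u => (z * u%:C) ^+ n * F u).
  apply: (@cintegrable01_le _ F _ 1) => //; first exact: cmeasurableM.
  move=> u /andP[u0 u1]; rewrite Normc.normcM ler_wpM2r ?normc_ge0//.
  rewrite normcX Normc.normcM normc_real gtr0_norm//.
  apply: exprn_ile1; first by rewrite mulr_ge0 ?normc_ge0 ?ltW.
  by rewrite mulr_ile1 ?normc_ge0// ltW.
(* This is the integrated form of [(z u)^n F = z^n P n + (z u)^(n+1) F], one step of the geometric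
   expansion; the sum over [n] telescopes. *)
have IS n : I n = z ^+ n * (m`!%:R / (n%:R + a) ^+ m.+1) + I n.+1.
  rewrite -cintegral01_power_log// ; last exact: iP.
  rewrite -cintegral01Zl; last exact: iP.
  rewrite /I -cintegral01D//; last first.
    apply: (cintegrable01_le (normc_ge0 (z ^+ n)) (iP n)).
      apply: cmeasurableM; first exact: cmeasurable_cst.
      by apply: cmeasurableM => //; exact: cmeasurable_cpowR.
    by move=> u _; rewrite Normc.normcM.
  apply: eq_cintegral01 => u u01; rewrite -/(P n u) PE// exprS exprMn; ring.
have f0 : m`!%:R != 0 :> R[i] by rewrite pnatr_eq0 -lt0n fact_gt0.
have sumE n : \sum_(k < n) lerch_term z m.+1 a k = (I 0%N - I n) / m`!%:R.
  elim: n => [|n IH]; first by rewrite big_ord0 subrr mul0r.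
  rewrite big_ord_recr /= IH /lerch_term [in RHS]/= .
  rewrite (IS n); field.
  have an0 : n%:R + a != 0 by apply: contraTneq (ak0 n) => ->; rewrite ltxx.
  by rewrite f0 expf_neq0.
have I0 : I 0%N = cintegral01 F by apply: eq_cintegral01 => u _; rewrite mul1r.
have [cr ci] := cintegral01_geometric_cvg0 z1 mF iF.
(* Division by [m!] is multiplication by a real number, hence acts on [Re] and [Im] separately. *)
have fE : (m`!%:R : R[i])^-1 = ((m`!%:R)^-1)%:C by rewrite fmorphV rmorph_nat.
split.
- under eq_fun do rewrite sumE fE complex_ReMr.
  rewrite fE complex_ReMr -I0; apply: cvgM; last exact: cvg_cst.
  rewrite -[X in _ --> X]subr0; under eq_fun do rewrite raddfB /=.
  apply: cvgB => //; exact: cvg_cst.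
- under eq_fun do rewrite sumE fE complex_ImMr.
  rewrite fE complex_ImMr -I0; apply: cvgM; last exact: cvg_cst.
  rewrite -[X in _ --> X]subr0; under eq_fun do rewrite raddfB /=.
  apply: cvgB => //; exact: cvg_cst.
Qed.

(** Origin of the constant: cancelling [ln u] against one factor of [(- ln u)^(m+1)] leaves a minus
    sign, [m+1] clears the denominator of the weight, and [1 / m!] normalizes the Gamma
    integrals. *)
Lemma lerch_series_square (R : realType) (z a : R[i]) m : normc z <= 1 ->
  cintegrable (lerch_integrand z m.+1 a) ->
  cseries_to (lerch_term z m.+1 a)
    ((- (m.+1%:R / m`!%:R))%:C * cintegral (lerch_integrand z m.+1 a)).
Proof.
move=> z1 [ir ii].
pose G (u : R) : R[i] := cpowR u (a - 1) / ((1 - z * u%:C) * (ln u)%:C).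
pose F (u : R) : R[i] := cpowR u (a - 1) * ((- ln u) ^+ m)%:C / (1 - z * u%:C).
have LE p : lerch_integrand z m.+1 a p = G (p.1 * p.2) * ((- ln p.2) ^+ m)%:C.
  by rewrite /lerch_integrand /G /= mulrAC.
have LEr p : Re (lerch_integrand z m.+1 a p) = Re (G (p.1 * p.2)) * (- ln p.2) ^+ m.
  by rewrite LE complex_ReMr.
have LEi p : Im (lerch_integrand z m.+1 a p) = Im (G (p.1 * p.2)) * (- ln p.2) ^+ m.
  by rewrite LE complex_ImMr.
have [mGr mGi] : cmeasurable G.
  apply: cmeasurableM; first exact: cmeasurable_cpowR.
  apply: cmeasurableV; apply: cmeasurableM.
    apply: cmeasurableD; first exact: cmeasurable_cst.
    under eq_fun do rewrite -mulNr.
    by apply: cmeasurableM; [exact: cmeasurable_cst|exact: cmeasurable_real].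
  by apply: cmeasurable_real; exact: measurable_ln.
have {}ir : (@leb2 R).-integrable (@unit_square R)
    (EFin \o (fun p => Re (G (p.1 * p.2)) * (- ln p.2) ^+ m)).
  have -> : (fun p => Re (G (p.1 * p.2)) * (- ln p.2) ^+ m) =
      (fun p => Re (lerch_integrand z m.+1 a p)) by apply/funext => p; rewrite LEr.
  by [].
have {}ii : (@leb2 R).-integrable (@unit_square R)
    (EFin \o (fun p => Im (G (p.1 * p.2)) * (- ln p.2) ^+ m)).
  have -> : (fun p => Im (G (p.1 * p.2)) * (- ln p.2) ^+ m) =
      (fun p => Im (lerch_integrand z m.+1 a p)) by apply/funext => p; rewrite LEi.
  by [].
have [jr er] := integral_square mGr ir.
have [ji ei] := integral_square mGi ii.
pose H (u : R) := G u * ((- ln u) ^+ m.+1 / m.+1%:R)%:C.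
have iH : cintegrable01 H.
  split.
    by move: jr; rewrite (_ : (fun u => _) = (fun u => Re (H u)))//; apply/funext => u; rewrite complex_ReMr.
  by move: ji; rewrite (_ : (fun u => _) = (fun u => Im (H u)))//; apply/funext => u; rewrite complex_ImMr.
have cE : cintegral (lerch_integrand z m.+1 a) = cintegral01 H.
  rewrite /cintegral /cintegral01; congr (_ +i* _).
    under [LHS]eq_Rintegral do rewrite LEr.
    by rewrite er; apply: eq_Rintegral => u _; rewrite complex_ReMr.
  under [LHS]eq_Rintegral do rewrite LEi.
  by rewrite ei; apply: eq_Rintegral => u _; rewrite complex_ImMr.
have HF u : 0 < u < 1 -> - m.+1%:R * H u = F u.
  move=> u01; have /andP[u0 u1] := u01; rewrite /H /G /F.
  have d0 := lerch_den_neq0 z1 u01.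
  have l0 : (ln u)%:C != 0 :> R[i] by rewrite eq_complex /= lt_eqF// ln_lt0// u0.
  have -> : ((- ln u) ^+ m.+1 / m.+1%:R)%:C = - (ln u)%:C * ((- ln u) ^+ m)%:C / m.+1%:R.
    by rewrite rmorphM /= fmorphV rmorph_nat exprS rmorphM /= rmorphN.
  have m0 : m.+1%:R != 0 :> R[i] by rewrite pnatr_eq0.
  by move: (m.+1%:R) m0 => c c0; field; rewrite d0 l0 c0.
have iF : cintegrable01 F.
  apply: eq_cintegrable01 HF _.
  apply: (cintegrable01_le (normc_ge0 (- m.+1%:R)) iH).
    apply: cmeasurableM; first exact: cmeasurable_cst.
    apply: cmeasurableM => //; apply: cmeasurable_real; apply: measurable_funM => //.
    by apply: measurable_funX; apply: measurable_funN; exact: measurable_ln.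
  by move=> u _; rewrite Normc.normcM.
have := lerch_series01 z1 iF.
rewrite -(eq_cintegral01 HF) cintegral01Zl// cE.
by rewrite rmorphN rmorphM /= fmorphV !rmorph_nat mulrAC mulNr.
Qed.

(** * The size of z, and the specialization to the zeta function *)

(** The terms of a convergent series tend to 0, but for |z| > 1 the numerator grows exponentially
    while [|n + a|^s <= (2 n)^s] once [n >= |a|]. *)
Lemma lerch_defined_normc_le1 (R : realType) (z a : R[i]) s :
  lerch_defined z s a -> normc z <= 1.
Proof.
move=> [a0 [l [cr ci]]]; rewrite leNgt; apply/negP => z1.
have zp : 0 < normc z := lt_trans ltr01 z1.
have tr : Re (lerch_term z s a n) @[n --> \oo] --> (0 : R).
  rewrite -[X in _ --> X](subrr (Re l)).
  have crS := cr; rewrite -cvg_shiftS in crS.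
  have -> : (fun n => Re (lerch_term z s a n)) =
      (fun n => Re (\sum_(k < n.+1) lerch_term z s a k) -
                Re (\sum_(k < n) lerch_term z s a k)).
    by apply/funext => n; rewrite big_ord_recr /= complex_ReD addrAC subrr add0r.
  exact: (cvgB crS cr).
have ti : Im (lerch_term z s a n) @[n --> \oo] --> (0 : R).
  rewrite -[X in _ --> X](subrr (Im l)).
  have ciS := ci; rewrite -cvg_shiftS in ciS.
  have -> : (fun n => Im (lerch_term z s a n)) =
      (fun n => Im (\sum_(k < n.+1) lerch_term z s a k) -
                Im (\sum_(k < n) lerch_term z s a k)).
    by apply/funext => n; rewrite big_ord_recr /= complex_ImD addrAC subrr add0r.
  exact: (cvgB ciS ci).
have tn : `|Re (lerch_term z s a n)| + `|Im (lerch_term z s a n)| @[n --> \oo] --> (0 : R).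
  rewrite -[X in _ --> X](addr0 0); apply: cvgD; exact/norm_cvg0P.
have hz : 0 < ln (normc z) by rewrite ln_gt0.
set h := ln (normc z) in hz.
suff : \forall n \near \oo, False by case => N _ /(_ N (leqnn _)).
near=> n.
have n0 : 0 < (n%:R : R) by rewrite ltr0n; near: n; exists 1%N.
have t1 : normc (lerch_term z s a n) < 1.
  apply: le_lt_trans (normc_le_add _) _; near: n.
  exact: (cvgr_lt _ tn _ ltr01).
have an : normc a <= n%:R by near: n; exact: nbhs_infty_ger.
(* Beyond this threshold [(h n)^(s+1) / (s+1)! < (2 n)^s] fails, an inequality that
   [|z|^n = e^(h n)] and terms of modulus below 1 would force. *)
have bign : 2 ^+ s * s.+1`!%:R / h ^+ s.+1 < n%:R :> R by near: n; exact: nbhs_infty_gtr.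
have den : normc (n%:R + a) <= 2 * n%:R.
  apply: le_trans (le_normcD _ _) _.
  rewrite -(rmorph_nat (real_complex R)) normc_real ger0_norm// mulr_natl mulr2n.
  by rewrite lerD2l.
have dp : 0 < normc (n%:R + a).
  rewrite lt_neqAle normc_ge0 andbT eq_sym; apply: contra (a0 n) => /eqP.
  by move/Normc.eq0_normc => ->.
move: t1; rewrite /lerch_term Normc.normcM normcX -[X in _ * X]/(normc _).
have -> : normc ((n%:R + a) ^+ s)^-1 = (normc (n%:R + a) ^+ s)^-1.
  by rewrite Normc.normcV normcX.
rewrite ltr_pdivrMr ?exprn_gt0// mul1r => t1.
have t2 : normc z ^+ n < (2 * n%:R) ^+ s.
  by apply: lt_le_trans t1 _; rewrite lerXn2r// nnegrE ?normc_ge0// mulr_ge0// ltW.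
have e : normc z ^+ n = expR (h * n%:R).
  by rewrite expRM_natr lnK.
have := expR_ge1Dxn s (mulr_ge0 (ltW hz) (ltW n0)).
rewrite -e => h1; have : (h * n%:R) ^+ s.+1 / s.+1`!%:R < (2 * n%:R) ^+ s.
  by apply: le_lt_trans t2; apply: le_trans h1; rewrite lerDr.
have f0 : 0 < s.+1`!%:R :> R by rewrite ltr0n fact_gt0.
rewrite ltr_pdivrMr// !exprMn [n%:R ^+ s.+1]exprS mulrA [X in _ < X]mulrAC.
rewrite ltr_pM2r ?exprn_gt0// mulrC -ltr_pdivlMr ?exprn_gt0//.
by move=> h2; have := lt_trans bign h2; rewrite ltxx.
Unshelve. all: by end_near. Qed.

Theorem theorem3p2 (R : realType) (s : nat) (hs : (1 < s)%N) :
  (forall (z a : R[i]),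
      lerch_defined z s a ->
      cintegrable (lerch_integrand z s a) ->
      cseries_to (lerch_term z s a)
        ((- (s%:R / (s.-1)`!%:R))%:C%C * cintegral (lerch_integrand z s a))) /\
  ((@leb2 R).-integrable (@unit_square R) (EFin \o zeta_integrand (R:=R) s) ->
   @riemann_zeta R s =
     s%:R / (s.-1)`!%:R * (-1) ^+ s *
       Rintegral (@leb2 R) (@unit_square R) (zeta_integrand (R:=R) s)).
Proof.
case: s hs => // m _ /=; split => [z a za|iz].
  by apply: lerch_series_square; exact: lerch_defined_normc_le1 za.
have mS : measurable (@unit_square R) by apply: measurableX.
(* At [z = a = 1] the integrand is real and [(- ln y)^m] contributes [(-1)^m]; with the minus sign
   of the constant this becomes [(-1)^s], where [s = m+1]. *)
have LE (p : R * R) : lerch_integrand 1 m.+1 1 p = ((-1) ^+ m * zeta_integrand m.+1 p)%:C.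
  rewrite /lerch_integrand /zeta_integrand /= subrr mul1r.
  have -> : cpowR (p.1 * p.2) 0 = 1 by rewrite /cpowR !mul0r expR0 cos0 sin0 mul1r.
  rewrite mul1r [(- ln p.2) ^+ m]exprNn !rmorphM /= fmorphV !rmorphM /= rmorphB /=.
  by rewrite !rmorphM /= rmorph1 mulrA.
have iL : cintegrable (lerch_integrand (1 : R[i]) m.+1 1).
  split.
    rewrite (_ : EFin \o _ = (fun p => ((-1) ^+ m)%:E * (EFin \o zeta_integrand m.+1) p)%E).
      exact: integrableZl.
    by apply/funext => p; rewrite -EFinM /comp LE.
  rewrite (_ : EFin \o _ = cst 0%E); first exact: integrable0.
  by apply/funext => p; rewrite /comp LE.
have z1 : normc (1 : R[i]) <= 1 by rewrite Normc.normc1.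
have [cr _] := lerch_series_square z1 iL.
have cI : Re (cintegral (lerch_integrand (1 : R[i]) m.+1 1)) =
    (-1) ^+ m * Rintegral (@leb2 R) (@unit_square R) (zeta_integrand m.+1).
  by rewrite -RintegralZl//; apply: eq_Rintegral => p _; rewrite LE.
transitivity (Re ((- (m.+1%:R / m`!%:R))%:C *
    cintegral (lerch_integrand (1 : R[i]) m.+1 1))).
  (* At [z = a = 1] the Lerch term of index [k] is [(k+1)^(-s)], so the real parts of the partial
     sums are exactly the sums defining [riemann_zeta]. *)
  rewrite /riemann_zeta; apply: cvg_lim => //.
  apply: cvg_trans cr; apply: near_eq_cvg; near=> n.
  rewrite raddf_sum /=; apply: eq_bigr => k _.
  rewrite /lerch_term expr1n mul1r natr1 -(rmorph_nat (real_complex R)) -rmorphXn.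
  by rewrite -fmorphV.
by rewrite mulrC complex_ReMr cI exprS; ring.
Unshelve. all: by end_near. Qed.
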